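(* Let $f:[a,b]\to\mathbb{R}$ be a convex function. Let $n\ge 1$ and $N\ge 1$ be integers. Let $\mathbf{p}_1=(p_{1,1},\dots,p_{n,1})$ satisfy $p_{i,1}\ge 0$ for $i=1,\dots,n$ and $\sum_{i=1}^n p_{i,1}=1$. For each $k=1,\dots,N$ let $\mathbf{q}_k=(q_{1,k},\dots,q_{n,k})$ be a given $n$-tuple with $q_{i,k}>0$ for $i=1,\dots,n$ and $\sum_{i=1}^n q_{i,k}=1$. Let $\mathbf{x}_1=(x_{1,1},\dots,x_{n,1})\in[a,b]^n$. Let $j_1$ be a fixed index with $M_1=\max_{1\le i\le n}\frac{p_{i,1}}{q_{i,1}}=\frac{p_{j_1,1}}{q_{j_1,1}}$, and let $M_k$ and $\mathbf{x}_k=(x_{1,k},\dots,x_{n,k})$, $k=1,\dots,N$, be obtained by the recursion described in the context. Then $$J_n(f,\mathbf{x}_1,\mathbf{p}_1)-\sum_{k=1}^N M_k\,J_n(f,\mathbf{x}_k,\mathbf{q}_k)\ \le\ 0,$$ and $$M_k=\frac{p_{j_1,1}}{\prod_{m=1}^k q_{j_1,m}},\qquad k=1,\dots,N.$$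
   Context: Jensen functional: for a function $f$ on an interval, an $n$-tuple $\mathbf{x}=(x_1,\dots,x_n)$ of points of the interval and a weight $n$-tuple $\mathbf{p}=(p_1,\dots,p_n)$ with $\sum_i p_i=1$, $$J_n(f,\mathbf{x},\mathbf{p})=\sum_{i=1}^n p_i f(x_i)-f\Big(\sum_{i=1}^n p_i x_i\Big).$$ Recursion. The tuples $\mathbf{q}_1,\dots,\mathbf{q}_N$ are given a priori (not constructed). For $k=1,\dots,N$ put $$M_k=\max_{1\le i\le n}\frac{p_{i,k}}{q_{i,k}}=\frac{p_{j_k,k}}{q_{j_k,k}},$$ where $j_k$ is a specific (chosen) index at which the maximum is attained. For $k=2,\dots,N$ define $$p_{i,k}=p_{i,k-1}-M_{k-1}q_{i,k-1},\qquad x_{i,k}=x_{i,k-1}\qquad\text{for } i\in\{1,\dots,n\},\ i\ne j_{k-1}$$ (including those $i\neq j_{k-1}$ at which the maximum $M_{k-1}$ is also attained), and $$p_{j_{k-1},k}=M_{k-1},\qquad x_{j_{k-1},k}=\sum_{l=1}^n q_{l,k-1}x_{l,k-1}.$$ *)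

(* Defs.v *)
From HB Require Import structures.
From mathcomp Require Import all_boot all_order all_algebra.
From mathcomp Require Import all_classical all_reals all_analysis.

Set Implicit Arguments.
Unset Strict Implicit.
Unset Printing Implicit Defensive.

Import Order.TTheory GRing.Theory Num.Theory.

Local Open Scope ring_scope.

Definition Jensen (R : realType) (n : nat) (f : R -> R) (x p : 'I_n -> R) : R :=
  \sum_(i < n) p i * f (x i) - f (\sum_(i < n) p i * x i).

(* [M] is the maximum of the ratios [p i / q i], attained at (but possibly not
   only at) the index [j]. *)
Definition max_ratio_at (R : realType) (n : nat) (p q : 'I_n -> R)
    (M : R) (j : 'I_n) : Prop :=
  (forall i : 'I_n, p i / q i <= M) /\ M = p j / q j.

Definition refine_weights (R : realType) (n : nat) (p q : 'I_n -> R)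
    (M : R) (j : 'I_n) : 'I_n -> R :=
  fun i => if i == j then M else p i - M * q i.

Definition refine_points (R : realType) (n : nat) (x q : 'I_n -> R)
    (j : 'I_n) : 'I_n -> R :=
  fun i => if i == j then \sum_(l < n) q l * x l else x i.

(* Tuples are listed with the step first: [p k i] is $p_{i,k}$, and likewise for
   [q] and [x].  Steps run over 1, ..., N; the values of the sequences at other
   steps are unconstrained. *)
Definition Jensen_recursion (R : realType) (n N : nat)
    (q p x : nat -> 'I_n -> R) (M : nat -> R) (j : nat -> 'I_n) : Prop :=
  (forall k : nat, (1 <= k <= N)%N -> max_ratio_at (p k) (q k) (M k) (j k)) /\
  (forall k : nat, (2 <= k <= N)%N ->
     p k =1 refine_weights (p k.-1) (q k.-1) (M k.-1) (j k.-1) /\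
     x k =1 refine_points (x k.-1) (q k.-1) (j k.-1)).

(* Main.v *)
Require Import Defs.
From mathcomp Require Import all_boot all_order all_algebra.
From mathcomp Require Import all_classical all_reals all_analysis.
From mathcomp Require Import ring lra.

Set Implicit Arguments.
Unset Strict Implicit.

(** Write [(x', p')] for the points and weights produced from [(x, p)] by one
step of the recursion with maximal ratio [M = p j / q j].  Subtracting [M q]
from [p] annihilates the [j]-th weight, and the mass [M] freed by this is put
on the barycentre [Sum_l q l * x l], which becomes the new [j]-th point.  Hence
[(x', p')] has the same total mass and the same barycentre as [(x, p)], and
[Jensen f x p - M * Jensen f x q = Jensen f x' p']
([Jensen_refine]; all three equalities are instances of [sum_refine]).  The
sum over the steps therefore telescopes, and the left-hand side of the
inequality equals the Jensen functional of the weights obtained after [N]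
steps.

This functional is nonpositive because a refined weight [p i - M * q i] with
[i != j] is nonpositive by maximality of [M].  With a single positive weight
[p' j], the point [x' j] is a convex combination of the barycentre [xbar]
(coefficient [1 / p' j]) and of the other points (coefficients
[- p' i / p' j]), and convexity at [x' j] is the Jensen inequality with its
sign reversed ([Jensen_reverse]).  The barycentre [xbar] lies in the interval
because it is unchanged since the first step, where the weights are
nonnegative.

For the closed form of [M k]: both tuples of weights have sum [1], so every
maximal ratio is at least [1] and thus positive.  From the second step on, only
the weight at the previous index [j] is positive, so the maximum can be attained
there only.  All the indices [j k] are thus equal, and
[M k = M k.-1 / q k (j 1)]. *)

Import Order.TTheory GRing.Theory Num.Theory.

Local Open Scope classical_set_scope.
Local Open Scope ring_scope.

(** * Convexity with unnormalised weights *)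

Lemma wavg_itv (R : realFieldType) (a b v w y z : R) :
  0 < v -> 0 <= w -> a <= y <= b -> a <= z <= b ->
  a <= (v * y + w * z) / (v + w) <= b.
Proof.
move=> v0 w0 /andP[ay yb] /andP[az zb].
have vw0 : 0 < v + w by rewrite ltr_wpDr.
by rewrite ler_pdivlMr// ler_pdivrMr//; apply/andP; split; nra.
Qed.

Lemma convex_function_wavg (R : realType) (a b : R) (f : R -> R) (v w y z : R) :
  @convex_function R R^o `[a, b] f ->
  0 < v -> 0 <= w -> a <= y <= b -> a <= z <= b ->
  (v + w) * f ((v * y + w * z) / (v + w)) <= v * f y + w * f z.
Proof.
move=> hf v0 w0 hy hz.
have vw0 : 0 < v + w by rewrite ltr_wpDr.
have vw_neq0 : v + w != 0 by rewrite gt_eqF.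
have t0 : 0 <= v / (v + w) by rewrite divr_ge0 ?ltW.
have t1 : v / (v + w) <= 1 by rewrite ler_pdivrMr// mul1r lerDl.
have hy' : (y : R) \in (`[a, b]%classic : set R) by rewrite inE /= in_itv.
have hz' : (z : R) \in (`[a, b]%classic : set R) by rewrite inE /= in_itv.
set t := v / (v + w) in t0 t1.
have convE (c d : R) :
    t * c + (1 - t) * d = (v * c + w * d) / (v + w) by rewrite /t; field.
have : f (t * y + (1 - t) * z) <= t * f y + (1 - t) * f z.
  exact: (hf (Itv01 t0 t1) y z hy' hz').
by rewrite !convE ler_pdivlMr// mulrC.
Qed.

(** The distinguished point [y] of positive weight keeps the total weight
positive when the points are absorbed into it one at a time; without it, the
induction would have to single out vanishing partial sums of weights. *)
Lemma convex_function_wsum (R : realType) (a b : R) (f : R -> R) (n : nat)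
    (w x : 'I_n -> R) (v y : R) :
  @convex_function R R^o `[a, b] f ->
  (forall i, 0 <= w i) -> (forall i, a <= x i <= b) ->
  0 < v -> a <= y <= b ->
  (v + \sum_i w i) * f ((v * y + \sum_i w i * x i) / (v + \sum_i w i)) <=
  v * f y + \sum_i w i * f (x i).
Proof.
move=> hf; elim: n w x v y => [|n IHn] w x v y w0 hx v0 hy.
  by rewrite !big_ord0 !addr0 mulrAC divff ?gt_eqF// mul1r.
rewrite !big_ord_recl !addrA.
have vw0 : 0 < v + w ord0 by rewrite ltr_wpDr.
have := IHn (fun i => w (lift ord0 i)) (fun i => x (lift ord0 i)) _ _
  (fun i => w0 _) (fun i => hx _) vw0 (wavg_itv v0 (w0 ord0) hy (hx ord0)).
rewrite [in X in X -> _]mulrCA divff ?gt_eqF// mulr1 => /le_trans; apply.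
by rewrite lerD2r; apply: (@convex_function_wavg _ a b).
Qed.

Lemma barycentre_itv (R : realFieldType) (a b : R) (n : nat) (p x : 'I_n -> R) :
  (forall i, 0 <= p i) -> \sum_i p i = 1 -> (forall i, a <= x i <= b) ->
  a <= \sum_i p i * x i <= b.
Proof.
move=> p0 p1 hx; rewrite -[a]mul1r -[b]mul1r -p1 !mulr_suml.
by apply/andP; split; apply: ler_sum => i _;
  rewrite ler_wpM2l//; case/andP: (hx i).
Qed.

(** Moving the nonpositive weights to the other side of
[xbar = Sum_i p i * x i] exhibits [x j] as a weighted mean of [xbar], with
weight [1], and of the [x i], with weights [- p i]; the total weight is
[p j]. *)
Lemma Jensen_reverse (R : realType) (a b : R) (f : R -> R) (n : nat)
    (p x : 'I_n -> R) (j : 'I_n) :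
  @convex_function R R^o `[a, b] f ->
  0 < p j -> (forall i, i != j -> p i <= 0) -> \sum_i p i = 1 ->
  (forall i, a <= x i <= b) -> a <= \sum_i p i * x i <= b ->
  Jensen f x p <= 0.
Proof.
move=> hf pj0 pi0 p1 hx hxbar.
pose w i := if i == j then 0 else - p i.
have w0 i : 0 <= w i.
  by rewrite /w; case: eqVneq => // /pi0; rewrite oppr_ge0.
have sumw (g : 'I_n -> R) : \sum_i p i * g i + \sum_i w i * g i = p j * g j.
  rewrite -big_split (bigD1 j)//= big1 ?addr0 => [|i /negbTE ij].
    by rewrite /w eqxx mul0r addr0.
  by rewrite /w ij mulNr addrN.
have sw : 1 + \sum_i w i = p j.
  by have /= := sumw (fun=> 1); rewrite -!mulr_suml !mulr1 p1.
have := convex_function_wsum hf w0 hx ltr01 hxbar.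
rewrite sw !mul1r sumw [p j * x j]mulrC mulfK ?gt_eqF//.
by rewrite -(sumw (fun i => f (x i))) lerD2r /Jensen subr_le0.
Qed.

(** * One step of the recursion *)

Section Step.
Context {R : realType} {n : nat} {p q : 'I_n -> R} {M : R} {j : 'I_n}.
Hypotheses (hM : max_ratio_at p q M j) (q_gt0 : forall i, 0 < q i).

Lemma max_ratio_weight : M * q j = p j.
Proof. by case: hM => _ ->; rewrite divfK// gt_eqF. Qed.

Lemma le_max_ratio i : p i <= M * q i.
Proof. by case: hM => /(_ i) + _; rewrite ler_pdivrMr. Qed.

Lemma max_ratio_ge1 : \sum_i p i = 1 -> \sum_i q i = 1 -> 1 <= M.
Proof.
move=> p1 q1; rewrite -p1 -[M]mulr1 -q1 mulr_sumr.
by apply: ler_sum => i _; exact: le_max_ratio.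
Qed.

Lemma refine_weights_le0 i : i != j -> refine_weights p q M j i <= 0.
Proof. by move=> /negbTE ij; rewrite /refine_weights ij subr_le0 le_max_ratio. Qed.

(** Changing the point at [j] costs nothing, since [p - M q] vanishes there, so
only the new mass [M] sees the value [c].  Constant functions
give the conservation of mass, the points that of the barycentre, and the
values of [f] the telescoping of the Jensen functional. *)
Lemma sum_refine (g : 'I_n -> R) (c : R) :
  \sum_i refine_weights p q M j i * (if i == j then c else g i) =
  \sum_i p i * g i - M * \sum_i q i * g i + M * c.
Proof.
rewrite mulr_sumr -sumrB (bigD1 j)//= [in RHS](bigD1 j)//=.
rewrite /refine_weights !eqxx mulrA max_ratio_weight subrr add0r addrC.
congr (_ + _); apply: eq_bigr => i /negbTE ->.
by rewrite mulrBl mulrA.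
Qed.

Lemma sum_refine_weights :
  \sum_i q i = 1 -> \sum_i refine_weights p q M j i = \sum_i p i.
Proof.
move=> q1; have /= := sum_refine (fun=> 1) 1.
under eq_bigr do rewrite if_same.
by rewrite -!mulr_suml !mulr1 q1 mulr1 subrK.
Qed.

Lemma refine_barycentre (x : 'I_n -> R) :
  \sum_i refine_weights p q M j i * refine_points x q j i = \sum_i p i * x i.
Proof. by rewrite sum_refine subrK. Qed.

Lemma Jensen_refine (f : R -> R) (x : 'I_n -> R) :
  Jensen f (refine_points x q j) (refine_weights p q M j) =
  Jensen f x p - M * Jensen f x q.
Proof.
rewrite /Jensen refine_barycentre.
under eq_bigr do rewrite /refine_points (fun_if f).
by rewrite sum_refine; ring.
Qed.

Lemma refine_points_itv (a b : R) (x : 'I_n -> R) :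
  \sum_i q i = 1 -> (forall i, a <= x i <= b) ->
  forall i, a <= refine_points x q j i <= b.
Proof.
move=> q1 hx i; rewrite /refine_points; case: eqP => // _.
by apply: barycentre_itv => // l; exact: ltW.
Qed.

End Step.

(** * The whole recursion *)

Section Recursion.
Context {R : realType} {n N : nat} {q p x : nat -> 'I_n -> R} {M : nat -> R}
  {j : nat -> 'I_n}.
Hypotheses (hp_sum : \sum_i p 1%N i = 1)
  (hq_gt0 : forall k, (1 <= k <= N)%N -> forall i, 0 < q k i)
  (hq_sum : forall k, (1 <= k <= N)%N -> \sum_i q k i = 1)
  (hrec : Jensen_recursion N q p x M j).

Let hmax k : (1 <= k <= N)%N -> max_ratio_at (p k) (q k) (M k) (j k).
Proof. exact: hrec.1. Qed.

Lemma recursion_weights k : (1 <= k < N)%N ->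
  p k.+1 = refine_weights (p k) (q k) (M k) (j k).
Proof. by move=> hk; apply/funext; case: (hrec.2 k.+1 hk). Qed.

Lemma recursion_points k : (1 <= k < N)%N ->
  x k.+1 = refine_points (x k) (q k) (j k).
Proof. by move=> hk; apply/funext; case: (hrec.2 k.+1 hk). Qed.

Lemma recursion_ind (P : nat -> Prop) :
  P 1%N -> (forall k, (1 <= k < N)%N -> P k -> P k.+1) ->
  forall k, (1 <= k <= N)%N -> P k.
Proof.
move=> P1 PS; elim=> [//|[//|k] IHk] hk.
by apply: PS => //; apply: IHk; exact: ltnW.
Qed.

Let range_leq {k} : (1 <= k < N)%N -> (1 <= k <= N)%N.
Proof. by case/andP=> -> /ltnW. Qed.

Lemma recursion_weights_sum k : (1 <= k <= N)%N -> \sum_i p k i = 1.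
Proof.
move: k; apply: recursion_ind => // k hk <-.
have hk' := range_leq hk.
rewrite recursion_weights//.
by rewrite (sum_refine_weights (hmax hk') (hq_gt0 hk'))// hq_sum.
Qed.

Lemma recursion_barycentre k : (1 <= k <= N)%N ->
  \sum_i p k i * x k i = \sum_i p 1%N i * x 1%N i.
Proof.
move: k; apply: recursion_ind => // k hk <-.
have hk' := range_leq hk.
rewrite recursion_weights// recursion_points//.
by rewrite (refine_barycentre (hmax hk') (hq_gt0 hk')).
Qed.

Lemma recursion_points_itv (a b : R) : (forall i, a <= x 1%N i <= b) ->
  forall k, (1 <= k <= N)%N -> forall i, a <= x k i <= b.
Proof.
move=> hx; apply: recursion_ind => // k hk IHk.
have hk' := range_leq hk.
rewrite recursion_points//.
exact: (refine_points_itv (hq_gt0 hk') (hq_sum hk') IHk).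
Qed.

Lemma recursion_Jensen (f : R -> R) k : (1 <= k <= N)%N ->
  Jensen f (x 1%N) (p 1%N) - \sum_(1 <= m < k) M m * Jensen f (x m) (q m) =
  Jensen f (x k) (p k).
Proof.
move: k; apply: recursion_ind => [|k hk IHk]; first by rewrite big_geq// subr0.
have hk' := range_leq hk.
have k1 : (1 <= k)%N by case/andP: hk.
rewrite big_nat_recr//= opprD addrA IHk recursion_weights// recursion_points//.
by rewrite (Jensen_refine (hmax hk') (hq_gt0 hk')).
Qed.

Lemma recursion_max_ratio_gt0 k : (1 <= k <= N)%N -> 0 < M k.
Proof.
move=> hk; apply: lt_le_trans ltr01 _.
exact: (max_ratio_ge1 (hmax hk) (hq_gt0 hk)
  (recursion_weights_sum hk) (hq_sum hk)).
Qed.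

(** The weight at the maximal index is positive, since the ratio is, whereas
refinement leaves no positive weight outside of the previous index. *)
Lemma recursion_index k : (1 <= k <= N)%N -> j k = j 1%N.
Proof.
move: k; apply: recursion_ind => // k hk <-.
have hk' := range_leq hk.
have hk1 : (1 <= k.+1 <= N)%N by case/andP: hk.
apply/eqP; apply/negPn/negP => jk.
have := refine_weights_le0 (hmax hk') (hq_gt0 hk') jk.
rewrite -recursion_weights// -(max_ratio_weight (hmax hk1) (hq_gt0 hk1)).
by rewrite leNgt mulr_gt0 ?recursion_max_ratio_gt0 ?hq_gt0.
Qed.

Lemma recursion_max_ratio k : (1 <= k <= N)%N ->
  M k = p 1%N (j 1%N) / \prod_(1 <= m < k.+1) q m (j 1%N).
Proof.
move=> hk.
have hN : (1 <= N)%N by case/andP: hk => /leq_trans; apply.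
move: k hk; apply: recursion_ind => [|k hk IHk].
  by rewrite big_nat1; case: (@hmax 1%N hN).
have hk' := range_leq hk.
have hk1 : (1 <= k.+1 <= N)%N by case/andP: hk.
have [_ ->] := hmax hk1.
rewrite recursion_weights// !recursion_index// /refine_weights eqxx IHk.
by rewrite [in RHS]big_nat_recr//= invfM mulrA.
Qed.

End Recursion.

Theorem theorem7 (R : realType) (a b : R) (f : R -> R) (n N : nat)
    (q p x : nat -> 'I_n -> R) (M : nat -> R) (j : nat -> 'I_n)
    (hf : @convex_function R R^o `[a, b] f)
    (hn : (1 <= n)%N) (hN : (1 <= N)%N)
    (hp_ge0 : forall i : 'I_n, 0 <= p 1%N i)
    (hp_sum : \sum_(i < n) p 1%N i = 1)
    (hq_gt0 : forall k : nat, (1 <= k <= N)%N -> forall i : 'I_n, 0 < q k i)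
    (hq_sum : forall k : nat, (1 <= k <= N)%N -> \sum_(i < n) q k i = 1)
    (hx : forall i : 'I_n, a <= x 1%N i <= b)
    (hrec : Jensen_recursion N q p x M j) :
  Jensen f (x 1%N) (p 1%N)
    - \sum_(1 <= k < N.+1) M k * Jensen f (x k) (q k) <= 0 /\
  (forall k : nat, (1 <= k <= N)%N ->
     M k = p 1%N (j 1%N) / \prod_(1 <= m < k.+1) q m (j 1%N)).
Proof.
split; last exact: (recursion_max_ratio hp_sum hq_gt0 hq_sum hrec).
have NN : (1 <= N <= N)%N by rewrite hN leqnn.
have hmaxN := hrec.1 N NN.
have qN0 := hq_gt0 N NN.
(* The telescoped functional belongs to the refinement following step N, which
     is not a term of the sequences. *)
rewrite big_nat_recr//= opprD addrA (recursion_Jensen hq_gt0 hrec f NN).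
rewrite -(Jensen_refine hmaxN qN0).
apply: (Jensen_reverse (j := j N) hf).
- rewrite /refine_weights eqxx.
  exact: (recursion_max_ratio_gt0 hp_sum hq_gt0 hq_sum hrec NN).
- exact: (refine_weights_le0 hmaxN qN0).
- rewrite (sum_refine_weights hmaxN qN0 (hq_sum N NN)).
  exact: (recursion_weights_sum hp_sum hq_gt0 hq_sum hrec NN).
- apply: (refine_points_itv qN0 (hq_sum N NN)).
  exact: (recursion_points_itv hq_gt0 hq_sum hrec hx NN).
- rewrite (refine_barycentre hmaxN qN0) (recursion_barycentre hq_gt0 hrec NN).
  exact: barycentre_itv.
Qed.
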